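(* Let $\kappa$ be an infinite cardinal, and let $\mathcal{L}\subseteq\mathrm{Scat}_\kappa$ be nonempty and downward $\preceq$-closed and such that $\trianglelefteq^{\mathcal{L}}_\kappa$ is transitive. Then $\trianglelefteq^{\mathcal{L}}_\kappa$ has chains isomorphic to any $L\in\mathrm{Lin}_\kappa$ (including increasing and decreasing chains of order type any $\alpha<\kappa^+$) and, if $\kappa^{<\kappa}=\kappa$, chains of order type $\mathbb{R}_\kappa$; moreover, it has antichains of size $2^\kappa$.
   Context: Linear orders are reflexive and nonempty; $L\preceq L'$ means there is an embedding $f:L\to L'$, i.e. $x\le_L y\iff f(x)\le_{L'}f(y)$. For a cardinal $\kappa$, $\mathrm{LO}_\kappa$ is the set of (codes for) linear orders with domain $\kappa$, $\mathrm{Lin}_\kappa=\bigcup_{0<\lambda\le\kappa}\mathrm{LO}_\lambda$ ($\lambda$ ranging over cardinals), i.e. the nonempty linear orders of size at most $\kappa$, and $\mathrm{Scat}_\kappa\subseteq\mathrm{Lin}_\kappa$ consists of the scattered ones (those $L$ with $\mathbb{Q}\not\preceq L$). $\mathcal{L}\subseteq\mathrm{Lin}_\kappa$ is downward $\preceq$-closed if $K\in\mathrm{Lin}_\kappa$, $K\preceq L\in\mathcal{L}$ imply $K\in\mathcal{L}$; membership is meant up to isomorphism. A subset $I$ of $L$ is convex if $x\le_L y\le_L z$ and $x,z\in I$ imply $y\in I$. A $K$-convex partition of $L$ is a partition $(L_k)_{k\in K}$ of $L$ (into nonempty sets) such that $k<_K k'\iff$ every element of $L_k$ is $<_L$ every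 element of $L_{k'}$. $L\trianglelefteq^{\mathcal{L}}L'$ iff there are $K\in\mathcal{L}$, a $K$-convex partition $(L_k)_{k\in K}$ of $L$, and an embedding $f$ of $L$ into $L'$ such that each $f(L_k)$ is a convex subset of $L'$. $\trianglelefteq^{\mathcal{L}}_\kappa$ is the restriction of $\trianglelefteq^{\mathcal{L}}$ to $\mathrm{LO}_\kappa$. A chain isomorphic to (of order type) a linear order $M$ is a family $(L_x)_{x\in M}$ in $\mathrm{LO}_\kappa$ with $L_x\trianglelefteq^{\mathcal{L}}_\kappa L_y\iff x\le_M y$; an antichain is a set of pairwise $\trianglelefteq^{\mathcal{L}}_\kappa$-incomparable elements. $\mathbb{L}_\kappa=({}^\kappa\kappa,\le_{\mathrm{lex}})$ is the set of functions from $\kappa$ to $\kappa$ ordered lexicographically, and $\mathbb{R}_\kappa=\mathbb{L}_\kappa^*+(\mathbb{L}_\kappa\setminus\{\min\mathbb{L}_\kappa\})$, where $*$ denotes the reverse order. *)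

(* Defs.v *)
From mathcomp Require Import all_boot all_order all_algebra.
From mathcomp Require Import all_classical wochoice.

Set Implicit Arguments.
Unset Strict Implicit.
Unset Printing Implicit Defensive.

Import Order.TTheory.
Local Open Scope classical_set_scope.
Local Open Scope card_scope.

Definition strict (T : Type) (R : rel T) : rel T :=
  fun x y => R x y && ~~ R y x.

Definition dual_rel (T : Type) (R : rel T) : rel T := fun x y => R y x.

Definition sum_rel (T U : Type) (R : rel T) (S : rel U) : rel (T + U) :=
  fun u v => match u, v with
  | inl x, inl y => R x y
  | inl _, inr _ => true
  | inr _, inl _ => false
  | inr x, inr y => S x y
  end.

Definition embeds (T U : Type) (R : rel T) (S : rel U) : Prop :=
  exists f : T -> U, {mono f : x y / R x y >-> S x y}.

Definition scattered (T : Type) (R : rel T) : Prop :=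
  ~ embeds (fun p q : rat => (p <= q)%O) R.

Record linorder := Linorder {
  carrier :> Type;
  lin_le :> rel carrier;
  lin_total : total_order lin_le;
  lin_nonempty : [set: carrier] !=set0
}.

(* A cardinal is given as an initial ordinal: a type with a (reflexive)
   well-order such that no proper initial segment is as large as the whole.
   [well_order] asks that every nonempty subset have a unique minimum, which
   already makes the relation a total order. *)
Definition is_cardinal (kappa : Type) (le : rel kappa) : Prop :=
  well_order le /\
  forall a : kappa, ~ ([set: kappa] #<= [set b : kappa | strict le b a]).

Definition LO (kappa : Type) := {R : rel kappa | total_order R}.

Definition LO_rel (kappa : Type) (R : LO kappa) : rel kappa := sval R.
Coercion LO_rel : LO >-> rel.

(* Membership in Lin_kappa, Scat_kappa, and in their downward closed
   subclasses is meant up to isomorphism, so carriers are arbitrary types of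
   size at most kappa instead of cardinals lambda <= kappa. *)
Definition Lin (kappa : Type) : set linorder :=
  [set L : linorder | [set: L] #<= [set: kappa]].

Definition Scat (kappa : Type) : set linorder :=
  [set L : linorder | Lin kappa L /\ scattered L].

Definition downward_closed (kappa : Type) (C : set linorder) : Prop :=
  forall K L : linorder, Lin kappa K -> embeds K L -> C L -> C K.

Definition convex (T : Type) (L : rel T) (I : set T) : Prop :=
  forall x y z, L x y -> L y z -> I x -> I z -> I y.

Definition convex_partition (T U : Type) (L : rel T) (K : rel U)
    (P : U -> set T) : Prop :=
  partition [set: U] P [set: T] /\
  forall k k', strict K k k' <->
    (forall x y, P k x -> P k' y -> strict L x y).

Definition convex_embeds (C : set linorder) (T T' : Type)
    (L : rel T) (L' : rel T') : Prop :=
  exists2 K : linorder, C K &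
  exists P : K -> set T, convex_partition L K P /\
  exists f : T -> T', {mono f : x y / L x y >-> L' x y} /\
    forall k, convex L' (f @` P k).

Definition has_chain (kappa : Type) (C : set linorder)
    (I : Type) (M : rel I) : Prop :=
  exists F : I -> LO kappa,
    forall x y, convex_embeds C (F x) (F y) <-> M x y.

Definition is_antichain (kappa : Type) (C : set linorder)
    (A : set (LO kappa)) : Prop :=
  forall R S : LO kappa, A R -> A S -> R <> S ->
    ~ convex_embeds C R S /\ ~ convex_embeds C S R.

Definition lex (kappa : Type) (le : rel kappa) : rel (kappa -> kappa) :=
  fun f g => `[< f = g \/ exists a : kappa,
    (forall b, strict le b a -> f b = g b) /\ strict le (f a) (g a) >].

Definition nonmin (kappa : Type) (le : rel kappa) : set (kappa -> kappa) :=
  [set f | ~ minimum_of (lex le) predT f].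

(* R_kappa = L_kappa^* + (L_kappa \ {min L_kappa}), where L_kappa is [lex]. *)
Definition Rkappa (kappa : Type) (le : rel kappa) :
    rel ((kappa -> kappa) + nonmin le) :=
  sum_rel (dual_rel (lex le)) (relpre sval (lex le)).
Arguments Rkappa [kappa] le _ _.

(* kappa^{<kappa} = kappa, with kappa^{<kappa} the number of sequences in kappa
   of some length a < kappa; the ordinal a is the set of its predecessors. *)
Definition weak_power_eq (kappa : Type) (le : rel kappa) : Prop :=
  [set: {a : kappa & [set b : kappa | strict le b a] -> kappa}]
    #= [set: kappa].

(* Main.v *)
Require Import Defs.
From mathcomp Require Import all_boot all_order all_algebra.
From mathcomp Require Import all_classical wochoice.

(** To a total order [J] of size at most [kappa], injected into [kappa] by [l],
    and to a subset [I] of [J] one associates the order [shuffle I], of size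
    [kappa], which is the sum of a fixed bottom part, a dense family of blocks of
    order type [kappa], and of the orders [D_j] for [j] in [I], where [D_j] is a
    family of blocks of order type [l j + 1] indexed by the rationals.

    If [shuffle I] is piecewise convexly embedded into [shuffle I'] with a
    scattered set of pieces, then [I] is included in [I'] ([shuffle_recovery]).
    Indeed, for [j] in [I], the rationals do not embed into the set of pieces, so
    that some piece contains points of two distinct blocks of [D_j], hence an
    interval of blocks, which is mapped onto a convex subset of [shuffle I']. A
    block is well-ordered, so its image lies in one block, and two distinct
    blocks are separated by a dense order, so their images lie in distinct
    blocks. Therefore an inner block is mapped onto a whole block
    ([block_recovery]), and as an isomorphism between initial segments of a
    well-order is the identity, that block has index [j], which is thus in [I'].

    Conversely, if [I] is an initial segment of [J] included in [I'], then
    [shuffle I] is an initial segment of [shuffle I'], and the inclusion is a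
    convex embedding with a single piece. So every order that is represented by
    inclusion between initial segments of an order of size at most [kappa] is the
    type of a chain ([chain_of_cuts]). This applies to an order of size at most
    [kappa], by means of its principal initial segments; it applies to [Rkappa]
    when there are [kappa] sequences in [kappa] of length smaller than [kappa],
    because the eventually minimal functions are then a dense set of size [kappa]
    ([chain_Rkappa]).
    Subsets [I] that are pairwise incomparable for inclusion, of which
    [kappa + kappa] has [2 ^ kappa], give an antichain ([large_antichain]).

    The size of [shuffle I] is computed from [kappa * kappa <= kappa], which is
    obtained from Zorn's lemma ([infinite_square]). *)

Set Implicit Arguments.
Unset Strict Implicit.
Unset Printing Implicit Defensive.

Local Open Scope classical_set_scope.
Local Open Scope card_scope.

(** * Linear orders and well-orders *)

Section TotalOrders.
Variables (T : Type) (R : rel T).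
Hypothesis totR : total_order R.

Lemma total_order_refl x : R x x.
Proof. by have [[[+ _] _] _] := totR; apply. Qed.

Lemma total_order_trans y x z : R x y -> R y z -> R x z.
Proof. by have [[[_ +] _] _] := totR; apply. Qed.

Lemma total_order_anti x y : R x y -> R y x -> x = y.
Proof. by have [[_ +] _] := totR => + xy yx; apply; rewrite xy. Qed.

Lemma total_orderW x y : ~~ R x y -> R y x.
Proof. by have [_ /(_ x y)/orP[->|]] := totR. Qed.

Lemma strictE x y : strict R x y = ~~ R y x.
Proof.
rewrite /strict; case: (boolP (R y x)) => [_|/total_orderW ->].
  by rewrite andbF.
by [].
Qed.

Lemma strict_neq x y : R x y -> x <> y -> strict R x y.
Proof.
by move=> xy nxy; rewrite strictE; apply/negP => /(total_order_anti xy).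
Qed.

Lemma strict_le_trans y x z : strict R x y -> R y z -> strict R x z.
Proof.
rewrite !strictE => xy yz; apply: contra xy => zx; exact: total_order_trans zx.
Qed.

Lemma total_order_relpre (U : Type) (h : U -> T) :
  injective h -> total_order (relpre h R).
Proof.
move=> hI; split; first split; first split.
- by move=> x; exact: total_order_refl.
- by move=> y x z; exact: total_order_trans.
- by move=> x y /andP[xy yx]; apply: hI; exact: total_order_anti xy yx.
- by move=> x y; case: totR => _; apply.
Qed.

Lemma total_order_dual : total_order (dual_rel R).
Proof.
split; first split; first split.
- by move=> x; exact: total_order_refl.
- by move=> y x z yx zy; exact: total_order_trans yx.
- by move=> x y /andP[xy yx]; exact: total_order_anti yx xy.
- by move=> x y; case: totR => _; apply.
Qed.

End TotalOrders.

Lemma total_order_sum (T U : Type) (R : rel T) (S : rel U) :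
  total_order R -> total_order S -> total_order (sum_rel R S).
Proof.
move=> tR tS; split; first split; first split.
- by case=> x /=; [exact: (total_order_refl tR)|exact: (total_order_refl tS)].
- by case=> y [] x [] z //=;
    [exact: (total_order_trans tR)|exact: (total_order_trans tS)].
- by case=> x [] y //= /andP[xy yx]; congr (_ _);
    [exact: (total_order_anti tR)|exact: (total_order_anti tS)].
- case=> x [] y //=; first by case: tR => _; apply.
  by case: tS => _; apply.
Qed.

(** The lexicographic product, with the first coordinate dominant. *)
Definition lex_prod (T U : Type) (R : rel T) (S : rel U) : rel (T * U) :=
  fun x y => R x.1 y.1 && (R y.1 x.1 ==> S x.2 y.2).

Lemma total_order_lex_prod (T U : Type) (R : rel T) (S : rel U) :
  total_order R -> total_order S -> total_order (lex_prod R S).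
Proof.
move=> tR tS; split; first split; first split.
- move=> x; rewrite /lex_prod (total_order_refl tR).
  by rewrite (total_order_refl tS) implybT.
- move=> y x z /andP[xy Sxy] /andP[yz Syz]; apply/andP; split.
    exact: total_order_trans yz.
  apply/implyP => zx; apply: (@total_order_trans _ _ tS y.2).
    by apply: (implyP Sxy); exact: total_order_trans zx.
  by apply: (implyP Syz); exact: total_order_trans xy.
- move=> [x1 x2] [y1 y2] /andP[/andP[/= xy Sxy] /andP[/= yx Syx]].
  by move: Sxy Syx; rewrite xy yx /= => *; congr (_, _);
    [exact: total_order_anti yx|exact: (total_order_anti tS)].
- move=> x y; rewrite /lex_prod.
  case: (boolP (R x.1 y.1)) => [_|/(total_orderW tR) ->] /=; last by [].
  case: (R y.1 x.1) => //=; by case: tS => _; apply.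
Qed.

Section LexProd.
Variables (T U : Type) (R : rel T) (S : rel U).
Hypotheses (totR : total_order R) (totS : total_order S).

Lemma lex_prod_fst x y : lex_prod R S x y -> R x.1 y.1.
Proof. by case/andP. Qed.

Lemma lex_prod_strict x y : strict R x.1 y.1 -> lex_prod R S x y.
Proof. by case/andP => xy /negPf yx; rewrite /lex_prod xy yx. Qed.

Lemma lex_prodE k x y : lex_prod R S (k, x) (k, y) = S x y.
Proof. by rewrite /lex_prod /= (total_order_refl totR). Qed.

Lemma strict_lex_prod_fst x y : strict R x.1 y.1 -> strict (lex_prod R S) x y.
Proof.
move=> xy; rewrite /strict lex_prod_strict //; apply/negP => /lex_prod_fst yx.
by move: xy; rewrite (strictE totR) yx.
Qed.

End LexProd.

Section WellOrders.
Variables (T : Type) (R : rel T).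
Hypothesis woR : well_order R.

Lemma well_order_min (A : set T) : A !=set0 ->
  exists2 m, A m & forall x, A x -> R m x.
Proof.
case=> a Aa; have [|m [[mA lbm] _]] := woR (A := [pred x | `[< A x >]]).
  by exists a; apply/asboolP.
exists m => [|x Ax]; first exact/asboolP.
by apply: lbm; apply/asboolP.
Qed.

Lemma well_order_refl x : R x x.
Proof.
have [|m -> /(_ x)] := well_order_min (A := [set x]); first by exists x.
exact.
Qed.

Lemma well_order_anti x y : R x y -> R y x -> x = y.
Proof.
move=> xy yx; have [|m [_ mU]] := woR (A := [pred z | `[< z = x \/ z = y >]]).
  by exists x; apply/asboolP; left.
have mx : m = x.
  apply: mU; split; first by apply/asboolP; left.
  by move=> z /asboolP[->|->] //; exact: well_order_refl.
rewrite -mx; apply: mU; split; first by apply/asboolP; right.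
by move=> z /asboolP[->|->] //; exact: well_order_refl.
Qed.

Lemma well_order_total_order : total_order R.
Proof.
have min3 x y z : exists2 m, m \in [set x; y; z] & [/\ R m x, R m y & R m z].
  have [|m mA mP] := well_order_min (A := [set x; y; z]).
    by exists x; left; left.
  by exists m; [exact/mem_set|split; apply: mP; rewrite /=; auto].
split; first split; first split.
- exact: well_order_refl.
- move=> y x z xy yz.
  have [m /set_mem[[->|->]|->] [mx my mz]] := min3 x y z => //.
    by rewrite (well_order_anti xy mx).
  by rewrite (well_order_anti yz my) in xy.
- by move=> x y /andP[]; exact: well_order_anti.
- move=> x y; have [m /set_mem[[->|->]|->] [mx my mz]] := min3 x y x.
  + by rewrite my.
  + by rewrite mx orbT.
  + by rewrite my.
Qed.

(** A strictly increasing map from one initial segment onto another is the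
    identity: consider the least point that it moves. *)
Lemma well_order_rigid (A B : set T) (h : T -> T) :
    (forall x y, A y -> R x y -> A x) -> (forall x y, B y -> R x y -> B x) ->
    (forall x y, A x -> A y -> R (h x) (h y) = R x y) -> h @` A = B ->
  A = B.
Proof.
have tR := well_order_total_order.
move=> dA dB hmono hAB; suff hid x : A x -> h x = x.
  by rewrite -hAB; apply/seteqP; split=> [x Ax|_ [x Ax <-]];
    [exists x => //; exact: hid|rewrite hid].
move=> Ax; apply: contrapT => hx.
have [|m [Am hm] mP] := well_order_min (A := [set y | A y /\ h y <> y]).
  by exists x.
have below y : A y -> strict R y m -> h y = y.
  move=> Ay ym; apply: contrapT => hy; move: ym; rewrite strictE//.
  by move/negP; apply; apply: mP.
have hmB : B (h m) by rewrite -hAB; exists m.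
case: (boolP (R (h m) m)) => [hmm|].
  have hmm' : strict R (h m) m by exact: strict_neq.
  have Ahm := dA _ _ Am hmm.
  have := below _ Ahm hmm' => hhm.
  move: hmm'; rewrite strictE // -(hmono m (h m)) // hhm.
  by rewrite total_order_refl.
rewrite -strictE // => mhm.
have : B m by apply: dB hmB _; case/andP: mhm.
rewrite -hAB => -[c Ac hc].
have cm : strict R c m by rewrite strictE // -hmono // hc -strictE.
by move: hc; rewrite (below c) // => cE; move: cm; rewrite cE /strict andbN.
Qed.

End WellOrders.

(** * Products of infinite sets *)

Lemma card_leTP (T U : Type) :
  [set: T] #<= [set: U] <-> exists f : T -> U, injective f.
Proof.
split=> [/card_leP[f]|[f fI]].
  exists (fun x => val (f (SigSub (mem_setT x)))) => x y /val_inj.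
  by move/(@inj _ _ _ f); rewrite !inE => /(_ I I) [].
have /injfunPex[g] :
    exists2 f : T -> U, set_fun [set: T] [set: U] f & set_inj [set: T] f.
  by exists f => // x y _ _; exact: fI.
exact: inj_card_le g.
Qed.

(** The graph of a partial injection. *)
Definition partial_inj (T U : Type) (G : set (T * U)) : Prop :=
  forall p q, G p -> G q -> (p.1 = q.1 <-> p.2 = q.2).

Lemma partial_inj_bigcup (T U : Type) (F : set (set (T * U))) :
  F `<=` @partial_inj T U -> total_on F subset ->
  partial_inj (\bigcup_(X in F) X).
Proof.
move=> FP Ftot p q [G FG Gp] [H FH Hq].
by have [GH|HG] := Ftot _ _ FG FH; [apply: (FP H)|apply: (FP G)] => //;
  [exact: GH|exact: HG].
Qed.

(** A maximal partial injection has full domain or full range. *)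
Lemma injection_total (T U : Type) :
  (exists f : T -> U, injective f) \/ (exists g : U -> T, injective g).
Proof.
have [G [PG Gmax]] := Zorn_bigcup (@partial_inj_bigcup T U).
have [domG|/existsNP[t tG]] := pselect (forall t, exists u, G (t, u)).
  left; have [f fP] := choice domG; exists f => x y fxy.
  exact/(PG _ _ (fP x) (fP y)).
have [ranG|/existsNP[u uG]] := pselect (forall u, exists t, G (t, u)).
  right; have [g gP] := choice ranG; exists g => x y gxy.
  exact/(PG _ _ (gP x) (gP y)).
exfalso; apply: (Gmax (G `|` [set (t, u)])).
  split=> [x|]; first by left.
  by move=> /(_ (t, u))/(_ (or_intror erefl)) Gtu; apply: tG; exists u.
move=> [x1 x2] [y1 y2] [Gx|[-> ->]] [Gy|[-> ->]] //=.
- exact: PG Gx Gy.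
- by split=> E; exfalso; [apply: tG; exists x2; rewrite -E
                         |apply: uG; exists x1; rewrite -E].
- by split=> E; exfalso; [apply: tG; exists y2; rewrite E
                         |apply: uG; exists y1; rewrite E].
Qed.

Section Square.
Variable T : Type.
Implicit Types G : set ((T * T) * T).

(** The points whose square is in the domain of the graph [G]. *)
Definition field_of G : set T := [set x | exists z, G ((x, x), z)].

(** [G] is the graph of an injection of [X * X] into [X], where [X] is
    [field_of G]. *)
Definition squaring G : Prop :=
  [/\ partial_inj G,
      forall x y z, G ((x, y), z) ->
        [/\ field_of G x, field_of G y & field_of G z] &
      forall x y, field_of G x -> field_of G y -> exists z, G ((x, y), z)].

Lemma squaring_bigcup (F : set (set ((T * T) * T))) :
  F `<=` squaring -> total_on F subset -> squaring (\bigcup_(X in F) X).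
Proof.
move=> FP Ftot; have fieldS G x : F G -> field_of G x ->
    field_of (\bigcup_(X in F) X) x.
  by move=> FG [z Gz]; exists z, G.
split.
- by apply: partial_inj_bigcup => // G /FP[].
- by move=> x y z [G FG Gxy]; have [_ /(_ _ _ _ Gxy)[? ? ?] _] := FP _ FG;
    split; apply: fieldS FG _.
- move=> x y [u [G FG Gx]] [v [H FH Hy]].
  have [GH|HG] := Ftot _ _ FG FH.
    have [_ _ /(_ x y)[||z Hz]] := FP _ FH; first by exists u; exact: GH.
      by exists v.
    by exists z, H.
  have [_ _ /(_ x y)[||z Hz]] := FP _ FG; first by exists u.
    by exists v; exact: HG.
  by exists z, G.
Qed.

Lemma squaring_countable (e : nat -> T) : injective e ->
  squaring [set p | exists m n, p = ((e m, e n), e (choice.pickle (m, n)))].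
Proof.
move=> eI; have fe n : field_of
    [set p | exists m n, p = ((e m, e n), e (choice.pickle (m, n)))] (e n).
  by exists (e (choice.pickle (n, n))), n, n.
split.
- move=> _ _ [m [n ->]] [m' [n' ->]] /=; split=> [[/eI -> /eI ->] //|].
  by move=> /eI/(pcan_inj choice.pickleK) [-> ->].
- by move=> _ _ _ [m [n [-> -> ->]]]; split; exact: fe.
- by move=> _ _ [? [m [_ [-> _ _]]]] [? [n [_ [-> _ _]]]];
    exists (e (choice.pickle (m, n))), m, n.
Qed.

(** If the complement of the field of a squaring contains a copy of the field,
    then the squaring can be extended to the union of the two copies. *)
Lemma squaring_extend G (u : T -> T) (x0 x1 : T) :
    squaring G -> field_of G x0 -> field_of G x1 -> x0 <> x1 ->
    {in field_of G &, injective u} ->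
    (forall x, field_of G x -> ~ field_of G (u x)) ->
  exists2 H, squaring H & G `<` H.
Proof.
set X := field_of G => -[Gpi GX Gtot] Xx0 Xx1 x01 uI uX.
have uI' x y : X x -> X y -> u x = u y -> x = y.
  by move=> Xx Xy; apply: uI; rewrite inE.
have /choice[p pP] : forall xy : T * T, exists z, X xy.1 -> X xy.2 -> G (xy, z).
  move=> [x y]; have [[Xx Xy]|nX] := pselect (X x /\ X y).
    by have [z Gz] := Gtot _ _ Xx Xy; exists z.
  by exists x => /= Xx Xy; exfalso; apply: nX.
have pX x y : X x -> X y -> X (p (x, y)).
  by move=> Xx Xy; have [] := GX _ _ _ (pP (x, y) Xx Xy).
have pI x y x' y' : X x -> X y -> X x' -> X y' ->
    p (x, y) = p (x', y') -> (x, y) = (x', y').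
  move=> Xx Xy Xx' Xy'.
  by move/(Gpi _ _ (pP (x, y) Xx Xy) (pP (x', y') Xx' Xy')).
(* The point [w b x] is the copy of [x] in the field or in its image by [u]. *)
pose w (b : bool) x := if b then u x else x.
pose t (b : bool) := if b then x1 else x0.
have Xt b : X (t b) by case: b.
have wI b c x y : X x -> X y -> w b x = w c y -> b = c /\ x = y.
  move=> Xx Xy; case: b; case: c => //=.
  - by move=> /uI' ->.
  - by move=> E; exfalso; apply: (uX x) => //; rewrite E.
  - by move=> E; exfalso; apply: (uX y) => //; rewrite -E.
have tI b c : t b = t c -> b = c.
  by case: b; case: c => //= E; exfalso; apply: x01.
(* A pair with an entry in the image of [u] is sent into that image, along a code
   of the tags of its entries and of the points that they copy. *)
pose new b c x y := u (p (p (t b, t c), p (x, y))).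
have newI b c x y b' c' x' y' : X x -> X y -> X x' -> X y' ->
    new b c x y = new b' c' x' y' -> [/\ b = b', c = c', x = x' & y = y'].
  move=> Xx Xy Xx' Xy' /uI' E.
  have Xtt d d' : X (p (t d, t d')) by exact: pX.
  have [E1 E2] := pI _ _ _ _ (Xtt _ _) (pX _ _ Xx Xy) (Xtt _ _) (pX _ _ Xx' Xy')
    (E (pX _ _ (Xtt _ _) (pX _ _ Xx Xy)) (pX _ _ (Xtt _ _) (pX _ _ Xx' Xy'))).
  have [/tI -> /tI ->] := pI _ _ _ _ (Xt _) (Xt _) (Xt _) (Xt _) E1.
  by have [-> ->] := pI _ _ _ _ Xx Xy Xx' Xy' E2.
have newX b c x y : X x -> X y -> ~ X (new b c x y).
  by move=> Xx Xy; apply: uX; do 2 apply: (pX) => //; exact: Xt.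
pose N : set ((T * T) * T) := [set q | exists b c x y,
  [/\ b || c, X x, X y & q = ((w b x, w c y), new b c x y)]].
have wH b x : X x -> field_of (G `|` N) (w b x).
  move=> Xx; case: b; last by have [z Gz] := Gtot _ _ Xx Xx; exists z; left.
  by exists (new true true x x); right; exists true, true, x, x.
have XH z : field_of (G `|` N) z -> exists b x, X x /\ z = w b x.
  move=> [z' [Gz|[b [c [x [y [_ Xx _ [-> _ _]]]]]]]]; last by exists b, x.
  by exists false, z; split=> //; exists z'.
exists (G `|` N); last first.
  split=> [q Gq|]; first by left.
  move=> /(_ ((w true x0, w true x0), new true true x0 x0)) HG.
  have Gx : G ((w true x0, w true x0), new true true x0 x0).
    by apply: HG; right; exists true, true, x0, x0.
  by have [Xu _ _] := GX _ _ _ Gx; exact: uX Xx0 Xu.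
have GN x y z b c x' y' : G (x, y, z) -> b || c -> X x' -> X y' ->
    ~ ((x, y) = (w b x', w c y') \/ z = new b c x' y').
  move=> Gxyz bc Xx' Xy'; have [Xx Xy Xz] := GX _ _ _ Gxyz.
  case=> [[xE yE]|zE]; last by apply: (newX b c x' y') => //; rewrite -zE.
  by case/orP: bc => E; [move: Xx; rewrite xE E|move: Xy; rewrite yE E];
    exact: uX.
split.
- move=> [[q1 q2] q3] [[r1 r2] r3] [Gq|[b [c [x [y [bc Xx Xy [-> -> ->]]]]]]]
    [Gr|[b' [c' [x' [y' [bc' Xx' Xy' [-> -> ->]]]]]]] /=.
  + exact: Gpi Gq Gr.
  + by split=> E; exfalso; apply: (GN _ _ _ _ _ _ _ Gq bc' Xx' Xy'); auto.
  + by split=> E; exfalso; apply: (GN _ _ _ _ _ _ _ Gr bc Xx Xy); auto.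
  + split=> [[/wI E1 /wI E2]|].
      by have [-> ->] := E1 Xx Xx'; have [-> ->] := E2 Xy Xy'.
    by move=> /newI[] // -> -> -> ->.
- move=> x y z [Gxyz|[b [c [x' [y' [bc Xx' Xy' [-> -> ->]]]]]]].
    by have [Xx Xy Xz] := GX _ _ _ Gxyz; split; apply: (wH false).
  split; [exact: wH|exact: wH|apply: (wH true)].
  by apply: (pX) => //; apply: (pX) => //; exact: Xt.
- move=> _ _ /XH[b [x [Xx ->]]] /XH[c [y [Xy ->]]].
  have [bc|] := boolP (b || c).
    by exists (new b c x y); right; exists b, c, x, y.
  case: b; case: c => //= _; have [z Gz] := Gtot _ _ Xx Xy.
  by exists z; left.
Qed.

(** An infinite set [T] satisfies [T * T <= T]: take a maximal squaring [G] that
    extends a countable one, with field [X]. By maximality the complement of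
    [X] contains no copy of [X], so it injects into [X], hence so does [T]
    (two disjoint copies of [X] fit into [X * X]), and
    [T * T <= X * X <= X <= T]. *)
Lemma infinite_square : infinite_set [set: T] ->
  exists h : T * T -> T, injective h.
Proof.
move=> /infiniteP/card_leTP[e eI].
set G0 := [set p | exists m n, p = ((e m, e n), e (choice.pickle (m, n)))].
have G0sq : squaring G0 by exact: squaring_countable.
(* The empty graph is allowed for the sake of the empty chain. *)
pose P G := G = set0 \/ (squaring G /\ G0 `<=` G).
have [|G [PG Gmax]] := @Zorn_bigcup _ P.
  move=> F FP Ftot.
  have [[G FG GN0]|F0] := pselect (exists2 G, F G & G <> set0); last first.
    left; apply/seteqP; split=> // x [G FG Gx].
    by apply: F0; exists G => // G_eq0; rewrite G_eq0 in Gx.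
  right; split; last first.
    by have [//|[_ G0G]] := FP _ FG; move=> x /G0G Gx; exists G.
  pose F' := F `&` squaring.
  have -> : \bigcup_(X in F) X = \bigcup_(X in F') X.
    apply/seteqP; split=> x [H FH Hx]; last by exists H => //; case: FH.
    exists H => //; split=> //; have [H0|[]//] := FP _ FH.
    by rewrite H0 in Hx.
  apply: squaring_bigcup => [H []//|H H' [FH _] [FH' _]]; exact: Ftot.
have [sqG G0G] : squaring G /\ G0 `<=` G.
  case: PG => // G_eq0; exfalso; apply: (Gmax G0); last by right; split.
  rewrite G_eq0; split=> // /(_ ((e 0, e 0), e (choice.pickle (0, 0)))).
  by apply; exists 0, 0.
have [Gpi GX Gtot] := sqG; pose X := field_of G.
have Xe n : X (e n).
  by exists (e (choice.pickle (n, n))); apply: G0G; exists n, n.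
have e01 : e 0 <> e 1 by move=> /eI.
have /choice[p pP] : forall xy : T * T, exists z, X xy.1 -> X xy.2 -> G (xy, z).
  move=> [x y]; have [[Xx Xy]|nX] := pselect (X x /\ X y).
    by have [z Gz] := Gtot _ _ Xx Xy; exists z.
  by exists x => /= Xx Xy; exfalso; apply: nX.
have pX x y : X x -> X y -> X (p (x, y)).
  by move=> Xx Xy; have [] := GX _ _ _ (pP (x, y) Xx Xy).
have pI x y x' y' : X x -> X y -> X x' -> X y' ->
    p (x, y) = p (x', y') -> x = x' /\ y = y'.
  move=> Xx Xy Xx' Xy'.
  by move/(Gpi _ _ (pP (x, y) Xx Xy) (pP (x', y') Xx' Xy')) => -[].
have [[g gI]|[f fI]] := injection_total X (~` X).
  exfalso; pose u x := if pselect (X x) is left Xx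
    then val (g (SigSub (mem_set Xx))) else x.
  have uE x (Xx : X x) : u x = val (g (SigSub (mem_set Xx))).
    by rewrite /u; case: pselect => // Xx'; congr (val (g _)); exact: val_inj.
  have uI : {in X &, injective u}.
    move=> x y /set_mem Xx /set_mem Xy; rewrite !uE => /val_inj/gI.
    by move/(congr1 val).
  have uX x : X x -> ~ X (u x).
    by move=> Xx; rewrite uE; exact: (set_mem (valP (g _))).
  have [H sqH GH] := squaring_extend sqG (Xe 0) (Xe 1) e01 uI uX.
  by apply: (Gmax H) => //; right; split=> // x /G0G; apply: GH.1.
have fX y : X (val (f y)) by exact: (set_mem (valP (f y))).
pose v x := match pselect (X x) with
  | left _ => p (x, e 0)
  | right nX => p (val (f (SigSub (mem_set (nX : (~` X) x)))), e 1)
  end.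
have vX x : X (v x) by rewrite /v; case: pselect => ?; exact: pX.
have vI : injective v.
  move=> x y; rewrite /v; case: pselect => Xx; case: pselect => Xy.
  - by move=> /pI[].
  - by move=> /pI[] // _ /e01.
  - by move=> /pI[] // _ /esym/e01.
  - by move=> /pI[] // /val_inj/fI/(congr1 val).
exists (fun xy => p (v xy.1, v xy.2)) => -[x y] [x' y'] /=.
by move=> /pI[] // /vI -> /vI ->.
Qed.

End Square.

Lemma infinite_two_points (T : Type) : infinite_set [set: T] ->
  exists x y : T, x <> y.
Proof. by move=> /infiniteP/card_leTP[e eI]; exists (e 0), (e 1) => /eI. Qed.

Lemma card_le_prodT (T U V : Type) : infinite_set [set: T] ->
  [set: U] #<= [set: T] -> [set: V] #<= [set: T] -> [set: U * V] #<= [set: T].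
Proof.
move=> /infinite_square[h hI] /card_leTP[f fI] /card_leTP[g gI].
apply/card_leTP; exists (fun x => h (f x.1, g x.2)) => -[x y] [x' y'] /hI[].
by move=> /fI -> /gI ->.
Qed.

Lemma card_le_sumT (T U V : Type) : infinite_set [set: T] ->
  [set: U] #<= [set: T] -> [set: V] #<= [set: T] -> [set: U + V] #<= [set: T].
Proof.
move=> infT /card_leTP[f fI] /card_leTP[g gI].
have [h hI] := infinite_square infT.
have [x0 [x1 x01]] := infinite_two_points infT.
apply/card_leTP; exists (fun x => match x with
  inl u => h (x0, f u) | inr v => h (x1, g v) end) => -[x|x] [y|y] /hI[].
- by move=> /fI ->.
- by move/x01.
- by move/esym/x01.
- by move=> /gI ->.
Qed.

(** A set of size at most that of an infinite total order injects into it so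
    as to avoid its maximum, if there is one. *)
Lemma injection_avoiding_max (T J : Type) (R : rel T) : total_order R ->
    infinite_set [set: T] -> [set: J] #<= [set: T] ->
  exists2 l : J -> T, injective l & forall j, exists c, ~~ R c (l j).
Proof.
move=> tR infT JT.
have /card_leTP[g gI] := card_le_sumT infT JT JT.
have [max_g|/existsNP[j0 max_j0]] :=
    pselect (forall j, exists c, ~~ R c (g (inl j))).
  by exists (g \o inl) => // x y /gI[].
exists (g \o inr) => [x y /gI[]//|j]; exists (g (inl j0)); apply/negP => j0j.
suff /gI : g (inr j) = g (inl j0) by [].
apply: (total_order_anti tR) j0j; apply/negPn/negP => nj.
by apply: max_j0; exists (g (inr j)).
Qed.

(** * Orders built from dense families of blocks *)

Definition rat_le : rel rat := fun p q => (p <= q)%O.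

Lemma total_order_rat_le : total_order rat_le.
Proof.
split; first split; first split.
- by move=> x; exact: Order.POrderTheory.lexx.
- by move=> y x z; exact: Order.POrderTheory.le_trans.
- exact: Order.POrderTheory.le_anti.
- exact: Order.TotalTheory.le_total.
Qed.

Lemma strict_rat_leE p q : strict rat_le p q = (p < q)%O.
Proof.
by rewrite (strictE total_order_rat_le) Order.TotalTheory.ltNge.
Qed.

Lemma rat_between p q : strict rat_le p q ->
  exists2 s, strict rat_le p s & strict rat_le s q.
Proof.
rewrite strict_rat_leE => pq; exists ((p + q) / 2%:R)%R.
  by rewrite strict_rat_leE (Num.Theory.midf_lt pq).
by rewrite strict_rat_leE (Num.Theory.midf_lt pq).
Qed.

Lemma rat_above p : exists q, strict rat_le p q.
Proof. by exists (p + 1)%R; rewrite strict_rat_leE Num.Theory.ltrDl. Qed.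

Section Shuffle.
Variables (kappa : Type) (le : rel kappa) (J : Type) (leJ : rel J).
Hypotheses (le_wo : well_order le) (leJ_tot : total_order leJ).
Variable l : J -> kappa.
Hypotheses (l_inj : injective l) (l_nomax : forall j, exists c, ~~ le c (l j)).

(** The index set: [J] below which a bottom element is added. *)
Definition le_idx : rel (unit + J) := sum_rel (fun _ _ => true) leJ.

(** The set of blocks is ordered by index, then by position in the rationals. *)
Definition le_block : rel ((unit + J) * rat) := lex_prod le_idx rat_le.

(** All shuffles are subsets of one ambient order, in which a point consists of
    a block and of an element of [kappa]. *)
Definition le_amb : rel ((unit + J) * rat * kappa) := lex_prod le_block le.

Let le_tot : total_order le := well_order_total_order le_wo.

Lemma total_order_le_idx : total_order le_idx.
Proof.
apply: total_order_sum => //.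
by split; first split; first split=> //; case=> [] [].
Qed.

Lemma total_order_le_block : total_order le_block.
Proof.
exact: total_order_lex_prod total_order_le_idx total_order_rat_le.
Qed.

Lemma total_order_le_amb : total_order le_amb.
Proof. exact: total_order_lex_prod total_order_le_block le_tot. Qed.

Lemma le_amb_fst x y : le_amb x y -> le_block x.1 y.1.
Proof. exact: lex_prod_fst. Qed.

(** Blocks of index [j] are copies of the initial segment of [kappa] with
    maximum [l j]; those of bottom index are copies of [kappa]. *)
Definition seg (i : unit + J) : set kappa :=
  if i is inr j then [set c | le c (l j)] else setT.

(** The sum, over the bottom index and the indices in [I], of the orders made of
    a dense family of blocks of that index. *)
Definition shuffle (I : set J) : set ((unit + J) * rat * kappa) :=
  [set x | (if x.1.1 is inr j then I j else True) /\ seg x.1.1 x.2].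

(** Between two blocks there is another one of the same index as the first. *)
Lemma block_between x y : strict le_block x y -> exists s,
  strict le_block x (x.1, s) /\ strict le_block (x.1, s) y.
Proof.
case: x y => [i p] [j q]; have tI := total_order_le_idx.
have tb := total_order_le_block; have tq := total_order_rat_le.
have up r s : strict rat_le r s -> strict le_block (i, r) (i, s).
  by rewrite (strictE tb) (strictE tq) /le_block (lex_prodE _ tI).
case: (boolP (le_idx j i)) => ji pq.
  have ij : i = j.
    by apply: (total_order_anti tI) ji; case/andP: pq => /lex_prod_fst.
  move: pq; rewrite -ij (strictE tb) /le_block (lex_prodE _ tI) -(strictE tq).
  by case/rat_between => s ps sq; exists s; split; apply: up.
have [s ps] := rat_above p; exists s; split; first exact: up.
by apply: (strict_lex_prod_fst _ tI); rewrite (strictE tI).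
Qed.

(** Let [g] be an embedding into a shuffle of the sum of copies of
    [{c | c <= m}] indexed by the rationals between [p] and [q], whose image
    contains every point that lies between [g p m] and [g q m]. Then each inner
    copy of [{c | c <= m}] is mapped onto a block. *)
Section BlockRecovery.
Variables (I : set J) (m : kappa) (p q : rat).
Variable g : rat -> kappa -> (unit + J) * rat * kappa.
Hypothesis pq : strict rat_le p q.
Let inS s := rat_le p s && rat_le s q.
Hypothesis g_in : forall s c, inS s -> le c m -> shuffle I (g s c).
Hypothesis g_mono : forall s c t d, inS s -> inS t -> le c m -> le d m ->
  le_amb (g s c) (g t d) = lex_prod rat_le le (s, c) (t, d).
Hypothesis g_conv : forall z, shuffle I z -> le_amb (g p m) z ->
  le_amb z (g q m) -> exists s c, [/\ inS s, le c m & z = g s c].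

Let tq := total_order_rat_le.
Let tb := total_order_le_block.
Let ta := total_order_le_amb.
Let lemm : le m m := total_order_refl le_tot m.

(** The image of a well-ordered copy of [{c | c <= m}] lies in one block, as
    distinct blocks have further blocks between them. *)
Lemma same_block s c d : strict rat_le p s -> strict rat_le s q ->
  le c m -> le d m -> (g s c).1 = (g s d).1.
Proof.
move=> ps sq; have Ss : inS s.
  by case/andP: ps sq => ps _ /andP[sq _]; apply/andP.
wlog cd : c d / le c d.
  move=> W cm dm; case: (boolP (le c d)) => [cd|/(total_orderW le_tot) dc].
    exact: W.
  by apply/esym/W.
move=> cm dm; apply: contrapT => ncd.
have [|e [em ce nce] emin] := well_order_min le_wo
    (A := [set e | [/\ le e m, le c e & (g s c).1 <> (g s e).1]]).
  by exists d.
have lece : le_amb (g s c) (g s e) by rewrite g_mono // lex_prodE.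
(* A point [z] in a block strictly between those of [g s c] and [g s e] comes from
   an element of the same copy strictly between [c] and [e], against the choice
   of [e]. *)
have ltce : strict le_block (g s c).1 (g s e).1.
  exact: (strict_neq tb) (lex_prod_fst lece) nce.
have [r [lt1 lt2]] := block_between ltce.
set z : (unit + J) * rat * kappa := ((g s c).1.1, r, (g s c).2).
have lcz : le_amb (g s c) z by exact: lex_prod_strict.
have lze : le_amb z (g s e) by exact: lex_prod_strict.
have Sp : inS p by rewrite /inS (total_order_refl tq); case/andP: pq.
have Sq : inS q by rewrite /inS (total_order_refl tq) andbT; case/andP: pq.
have [|||s' [c' [Ss' c'm zE]]] := g_conv (z := z).
- exact: (g_in Ss cm).
- apply: (total_order_trans ta) lcz; rewrite g_mono //.
  exact: lex_prod_strict.
- apply: (total_order_trans ta lze); rewrite g_mono //.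
  exact: lex_prod_strict.
rewrite zE !g_mono // in lcz lze.
have s'E : s = s'.
  exact: (total_order_anti tq) (lex_prod_fst lcz) (lex_prod_fst lze).
rewrite -s'E !lex_prodE // in lcz lze.
have neq1 : (g s c).1 <> z.1.
  by move=> E; move: lt1; rewrite -[(_, r)]/z.1 -E /strict andbN.
have neq2 : z.1 <> (g s e).1.
  by move=> E; move: lt2; rewrite -[(_, r)]/z.1 -E /strict andbN.
have /emin ec' : [/\ le c' m, le c c' & (g s c).1 <> (g s c').1].
  by split=> //; move: neq1; rewrite zE -s'E.
apply: neq2; rewrite zE -s'E; congr (_ _).1.
exact: (total_order_anti le_tot).
Qed.

(** No block contains points from the images of two distinct copies: the images
    [g r m], with [r] between [s] and [t], would form a densely ordered subset of
    this block, which is well-ordered. *)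
Lemma distinct_blocks s t c d : inS s -> inS t -> strict rat_le s t ->
  le c m -> le d m -> (g s c).1 <> (g t d).1.
Proof.
move=> Ss St st cm dm E.
have inSr r : strict rat_le s r -> strict rat_le r t -> inS r.
  move=> /andP[sr _] /andP[rt _]; case/andP: Ss => ps _; case/andP: St => _ tq'.
  by rewrite /inS (total_order_trans tq ps sr) (total_order_trans tq rt tq').
have same r : strict rat_le s r -> strict rat_le r t -> (g r m).1 = (g s c).1.
  move=> sr rt; have Sr := inSr _ sr rt; apply: (total_order_anti tb).
    rewrite E; apply: le_amb_fst.
    by rewrite g_mono //; exact: lex_prod_strict.
  apply: le_amb_fst.
  by rewrite g_mono //; exact: lex_prod_strict.
have [r0 sr0 r0t] := rat_between st.
(* The rational [r] gives the least image, and [u] is taken below it. *)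
have [|_ [r [sr rt] <-] rmin] := well_order_min le_wo (A :=
    [set (g r m).2 | r in [set r | strict rat_le s r /\ strict rat_le r t]]).
  by exists (g r0 m).2, r0.
have [u su ur] := rat_between sr.
have ut : strict rat_le u t by apply: (strict_le_trans tq ur); case/andP: rt.
have rm : le (g r m).2 (g u m).2 by apply: rmin; exists u.
have : ~~ le_amb (g r m) (g u m).
  rewrite g_mono //; try exact: inSr.
  apply/negP => /lex_prod_fst /=; move: ur; rewrite (strictE tq).
  by move/negP; exact.
rewrite [g r m]surjective_pairing [g u m]surjective_pairing !same //.
by rewrite /le_amb lex_prodE // rm.
Qed.

Lemma block_recovery : exists i : unit + J,
  (if i is inr j then I j else True) /\ seg i = [set c | le c m].
Proof.
have Sp : inS p by rewrite /inS (total_order_refl tq); case/andP: pq.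
have Sq : inS q by rewrite /inS (total_order_refl tq) andbT; case/andP: pq.
have [s ps sq] := rat_between pq.
have Ss : inS s by case/andP: ps sq => ps _ /andP[sq _]; apply/andP.
have same c : le c m -> (g s c).1 = (g s m).1 by move=> cm; exact: same_block.
set k := (g s m).1.
exists k.1; split; first by have [] := g_in Ss lemm.
apply/esym; apply: (well_order_rigid le_wo (h := fun c => (g s c).2)).
- by move=> x y ym xy; exact: (total_order_trans le_tot) ym.
- rewrite /seg; case: k.1 => // j x y yj xy.
  exact: (total_order_trans le_tot) yj.
- move=> x y xm ym; rewrite -[RHS](lex_prodE le tq s) -g_mono //.
  rewrite [g s x]surjective_pairing [g s y]surjective_pairing !same //.
  by rewrite /le_amb lex_prodE.
- apply/seteqP; split=> [_ [c cm <-]|d kd].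
    by have [_] := g_in Ss cm; rewrite same.
  have [||| s' [c [Ss' cm zE]]] := g_conv (z := (k, d)).
  + by split=> //; have [] := g_in Ss lemm.
  + apply: lex_prod_strict; apply: (strict_neq tb); last exact: distinct_blocks.
    apply: (@le_amb_fst _ (g s m)).
    by rewrite g_mono //; exact: lex_prod_strict.
  + apply: lex_prod_strict; apply: (strict_neq tb); last exact: distinct_blocks.
    apply: (@le_amb_fst (g s m)).
    by rewrite g_mono //; exact: lex_prod_strict.
  exists c => //; have kE : k = (g s' c).1 by rewrite -zE.
  suff -> : s = s' by rewrite -zE.
  apply: (total_order_anti tq); apply/negPn/negP; rewrite -(strictE tq) => ss'.
    by apply: (distinct_blocks Ss' Ss ss' cm lemm).
  by apply: (distinct_blocks Ss Ss' ss' lemm cm).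
Qed.

End BlockRecovery.

(** If the rationals are sent to the classes of a convex partition with
    scattered quotient, then two of them are sent to the same class. *)
Lemma scattered_same_class (K : linorder) (T : Type) (L : rel T)
    (P : K -> set T) (x : rat -> T) :
  scattered K -> convex_partition L K P ->
  (forall s t, strict rat_le s t -> strict L (x s) (x t)) ->
  exists k s t, [/\ strict rat_le s t, P k (x s) & P k (x t)].
Proof.
move=> scatK [[cov _ _] Pord] xmono; have tq := total_order_rat_le.
have tK := @lin_total K.
have /choice[k kP] : forall s, exists k, P k (x s).
  by move=> s; have : cover setT P (x s); [rewrite cov|case=> k _ Pk; exists k].
apply: contrapT => none; apply: scatK; exists k => s t.
have neq s' t' : strict rat_le s' t' -> k s' <> k t'.
  by move=> st E; apply: none; exists (k s'), s', t'; split=> //; rewrite E.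
have kle s' t' : strict rat_le s' t' -> K (k s') (k t').
  move=> st; apply/negPn/negP; rewrite -(strictE tK).
  move=> /(Pord _ _).1/(_ _ _ (kP t') (kP s')).
  by case/andP: (xmono _ _ st) => xst _ /andP[_]; rewrite xst.
change (K (k s) (k t) = rat_le s t).
case: (boolP (rat_le s t)) => [st|].
  have [->|nst] := pselect (s = t); first exact: total_order_refl.
  exact/kle/strict_neq.
rewrite -(strictE tq) => ts; apply/negP => kst.
exact: neq ts (total_order_anti tK (kle _ _ ts) kst).
Qed.

(** Piecewise convex embeddability between shuffles, with scattered sets of
    pieces, implies inclusion of their index sets. The shuffles are coded on
    arbitrary carriers by pullback of the ambient order. *)
Lemma shuffle_recovery (C : set linorder)
    (C_scat : forall K, C K -> scattered K) (I I' : set J) (T T' : Type)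
    (phi : T -> (unit + J) * rat * kappa)
    (phi' : T' -> (unit + J) * rat * kappa) :
  injective phi -> injective phi' ->
  range phi = shuffle I -> range phi' = shuffle I' ->
  convex_embeds C (relpre phi le_amb) (relpre phi' le_amb) -> I `<=` I'.
Proof.
move=> phiI phiI' rphi rphi' [K CK [P [Pconv [f [fmono fconv]]]]] j Ij.
have ta := total_order_le_amb; have tq := total_order_rat_le.
have tI := total_order_le_idx.
have /choice[psi0 psi0P] : forall sc : rat * kappa,
    exists x, le sc.2 (l j) -> phi x = (inr j, sc.1, sc.2).
  move=> [s c] /=.
  have pt c' : le c' (l j) -> range phi (inr j, s, c') by rewrite rphi; split.
  have [cj|ncj] := pselect (le c (l j)).
    by have [x _ <-] := pt _ cj; exists x.
  by have [x _ _] := pt _ (total_order_refl le_tot _); exists x => /ncj.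
pose psi s c := psi0 (s, c).
have psiP s c : le c (l j) -> phi (psi s c) = (inr j, s, c).
  exact: (psi0P (s, c)).
have ljlj := total_order_refl le_tot (l j).
have amb_psi s c t d : le c (l j) -> le d (l j) ->
    le_amb (phi (psi s c)) (phi (psi t d)) = lex_prod rat_le le (s, c) (t, d).
  move=> cj dj; rewrite !psiP // /le_amb /le_block /lex_prod /=.
  rewrite (total_order_refl leJ_tot) /=.
  by case: (rat_le s t) => //=; case: (rat_le t s).
have [|k [p [q [pq Pp Pq]]]] :=
    scattered_same_class (C_scat _ CK) Pconv (x := fun s => psi s (l j)).
  move=> s t st; rewrite /strict /= !amb_psi //.
  have := strict_lex_prod_fst le tq (x := (s, l j)) (y := (t, l j)) st.
  exact.
pose inS s := rat_le p s && rat_le s q.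
have [|||i [Ii segE]] := block_recovery (I := I') (m := l j)
    (g := fun s c => phi' (f (psi s c))) pq.
- by move=> s c _ _; rewrite -rphi'; exists (f (psi s c)).
- by move=> s c t d _ _ cj dj; rewrite -amb_psi //; exact: fmono.
- move=> z; rewrite -rphi' => -[y _ <-] py yq.
  have [w Pw fw] := fconv k _ _ _ py yq
    (ex_intro2 _ _ _ Pp erefl) (ex_intro2 _ _ _ Pq erefl).
  move: py yq; rewrite -fw.
  have fE x x' : le_amb (phi' (f x)) (phi' (f x')) = le_amb (phi x) (phi x').
    exact: fmono.
  have : shuffle I (phi w) by rewrite -rphi; exists w.
  rewrite !fE !psiP //; case phiw : (phi w) => [[i t] c] [_ /= ci] pw wq.
  have iE : i = inr j.
    by apply: (total_order_anti tI);
      [have /lex_prod_fst := le_amb_fst wq|have /lex_prod_fst := le_amb_fst pw].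
  rewrite {}iE in ci phiw pw wq; exists t, c; split=> //.
    have := le_amb_fst wq; have := le_amb_fst pw.
    by rewrite /= /le_block !lex_prodE // => -> ->.
  by congr (phi' (f _)); apply: phiI; rewrite psiP.
(* A block of bottom index has type [kappa], in which [l j] is not the maximum. *)
case: i Ii segE => [u _ segE|i Ii segE].
  have [c] := l_nomax j; have : seg (inl u) c by [].
  by rewrite segE /= => ->.
suff <- : i = j by [].
apply: l_inj; apply: (total_order_anti le_tot).
  have : seg (inr i) (l i) by exact: (total_order_refl le_tot).
  by rewrite segE.
by have : [set c | le c (l j)] (l j) by []; rewrite -segE.
Qed.

(** For an initial segment [I] of [J] included in [I'], the order [shuffle I] is
    an initial segment of [shuffle I']. *)
Lemma shuffle_initial (I I' : set J) : I `<=` I' ->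
  (forall i j, I j -> leJ i j -> I i) ->
  forall z x, shuffle I x -> shuffle I' z -> le_amb z x -> shuffle I z.
Proof.
move=> II' dI [[i r] c] [[i' r'] c'] [/= Ii' _] [/= I'i segi].
move=> /le_amb_fst/lex_prod_fst /= ii'; split=> //=.
by case: i i' ii' Ii' {I'i segi} => [//|j] [//|j'] /= jj' /dI; apply.
Qed.

Lemma shuffleS (I I' : set J) : I `<=` I' -> shuffle I `<=` shuffle I'.
Proof. by move=> II' [[[u|j] r] c] [Ij cj]; split=> //; exact: II'. Qed.

Hypothesis kappa_inf : infinite_set [set: kappa].

Lemma shuffle_card (I : set J) : [set: J] #<= [set: kappa] ->
  exists2 phi : kappa -> (unit + J) * rat * kappa,
    injective phi & range phi = shuffle I.
Proof.
move=> Jk; have nk : [set: nat] #<= [set: kappa] by exact/infiniteP.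
have [c0 _] := infinite_setN0 kappa_inf.
have Sk : shuffle I #<= [set: kappa].
  apply: card_le_trans (card_leT _) _.
  apply: card_le_prodT => //; apply: card_le_prodT => //.
    apply: card_le_sumT => //; apply/card_leTP.
    by exists (fun=> c0) => -[] [].
  by apply: card_le_trans nk; have := card_rat; rewrite card_eq_le => /andP[].
have kS : [set: kappa] #<= shuffle I.
  (* One block of bottom index already has the size of [kappa]. *)
  pose h (c : kappa) : (unit + J) * rat * kappa := (inl tt, 0%R, c).
  have hI : {in [set: kappa] &, injective h} by move=> x y _ _ [].
  have := inj_card_eq hI; rewrite card_eq_le => /andP[_ /card_le_trans]; apply.
  by apply: subset_card_le => _ [c _ <-].
have /card_bijP[f fbij] := Cantor_Bernstein kS Sk; have fI := bij_inj fbij.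
exists (fun c => val (f (SigSub (mem_setT c)))).
  by move=> x y /val_inj/fI/(congr1 val).
apply/seteqP; split=> [_ [c _ <-]|x Sx]; first exact: (set_mem (valP (f _))).
have [g _ fK] := fbij; pose y := g (SigSub (mem_set Sx)).
exists (val y) => //; have -> : SigSub (mem_setT (val y)) = y by exact: val_inj.
by rewrite /y fK.
Qed.

End Shuffle.

(** * Chains and antichains *)

Section Chains.
Variables (kappa : Type) (le : rel kappa).
Hypotheses (le_wo : well_order le) (kappa_inf : infinite_set [set: kappa]).
Variable C : set linorder.
Hypotheses (C_scat : C `<=` Scat kappa) (C_nonempty : C !=set0)
  (C_down : downward_closed kappa C).

(** The one-point order lies in [C], so that an embedding with convex image is a
    piecewise one. *)
Lemma convex_embedsW (T T' : Type) (L : rel T) (L' : rel T') (f : T -> T') :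
  [set: T] !=set0 -> {mono f : x y / L x y >-> L' x y} ->
  convex L' (range f) -> convex_embeds C L L'.
Proof.
move=> T0 fmono fconv.
have tot1 : total_order (fun _ _ : unit => true).
  by split; first split; first split=> //; case=> [] [].
pose K1 : linorder := @Linorder unit (fun _ _ => true) tot1
  (ex_intro _ tt I : [set: unit] !=set0).
have [c0 _] := infinite_setN0 kappa_inf.
exists K1.
  have [L0 CL0] := C_nonempty; have [x0 _] := @lin_nonempty L0.
  apply: C_down CL0; first by apply/card_leTP; exists (fun=> c0) => -[] [].
  by exists (fun=> x0) => x y /=; rewrite (total_order_refl (@lin_total L0)).
exists (fun=> setT); split; last by exists f.
split; last first.
  move=> [] []; rewrite /strict /=; split=> // H.
  by have [x _] := T0; have := H x x I I; rewrite andbN.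
split=> [|[] []|] //; apply/seteqP; split=> // x _; by exists tt.
Qed.

Lemma convex_embeds_refl (L : rel kappa) : convex_embeds C L L.
Proof.
apply: (@convex_embedsW _ _ L L id); first exact: infinite_setN0.
  by [].
by move=> x y z _ _ _ _; exists y.
Qed.

(** The shuffles of the subsets of [J], coded on [kappa]: piecewise convex
    embeddability implies inclusion, and the converse holds from an initial
    segment of [J]. *)
Lemma shuffle_family (J : Type) (leJ : rel J) :
    total_order leJ -> [set: J] #<= [set: kappa] ->
  exists F : set J -> LO kappa,
    (forall I I', convex_embeds C (F I) (F I') -> I `<=` I') /\
    (forall I I', (forall i j, I j -> leJ i j -> I i) -> I `<=` I' ->
       convex_embeds C (F I) (F I')).
Proof.
move=> tJ Jk; have [l l_inj l_nomax] :=
  injection_avoiding_max (well_order_total_order le_wo) kappa_inf Jk.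
have /choice[phi phiP] : forall I : set J,
    exists phi : kappa -> (unit + J) * rat * kappa,
    injective phi /\ range phi = shuffle le l I.
  by move=> I; have [phi] := shuffle_card le l kappa_inf I Jk; exists phi.
pose F I : LO kappa := exist (fun R : rel kappa => total_order R)
  (relpre (phi I) (le_amb le leJ))
  (total_order_relpre (total_order_le_amb le_wo tJ) (phiP I).1).
exists F; split=> I I'.
  apply: (shuffle_recovery le_wo tJ l_inj l_nomax) => [K /C_scat[]//||||].
  - exact: (phiP I).1.
  - exact: (phiP I').1.
  - exact: (phiP I).2.
  - exact: (phiP I').2.
move=> dI II'; have [[phiI rI] [phiI' rI']] := (phiP I, phiP I').
have /choice[f fE] : forall x, exists y, phi I' y = phi I x.
  move=> x; have : range (phi I') (phi I x); last by case=> y _; exists y.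
  by rewrite rI'; apply: (shuffleS II'); rewrite -rI; exists x.
apply: (@convex_embedsW _ _ _ _ f); first exact: infinite_setN0.
  by move=> x y; rewrite /LO_rel /= !fE.
move=> x y z _ yz _ [z' _ z'E]; have : range (phi I) (phi I' y).
  rewrite rI; apply: (shuffle_initial II' dI (x := phi I z')).
  - by rewrite -rI; exists z'.
  - by rewrite -rI'; exists y.
  - by rewrite -fE z'E.
by case=> w _ wE; exists w => //; apply: phiI'; rewrite fE.
Qed.

(** An order represented by inclusion between cuts of an order of size at most
    [kappa] is a chain. *)
Lemma chain_of_cuts (J X : Type) (leJ : rel J) (leX : rel X)
    (cut : X -> set J) :
    total_order leJ -> [set: J] #<= [set: kappa] ->
    (forall x i j, cut x j -> leJ i j -> cut x i) ->
    (forall x y, cut x `<=` cut y <-> leX x y) ->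
  has_chain kappa C leX.
Proof.
move=> tJ Jk cutd cutP; have [F [F1 F2]] := shuffle_family tJ Jk.
exists (F \o cut) => x y; rewrite -cutP; split; first exact: F1.
by apply: F2; exact: cutd.
Qed.

Lemma chain_of_total_order (X : Type) (leX : rel X) :
  total_order leX -> [set: X] #<= [set: kappa] -> has_chain kappa C leX.
Proof.
move=> tX Xk; apply: (chain_of_cuts (cut := fun x => [set y | leX y x]) tX Xk).
  by move=> x i j jx ij; exact: (total_order_trans tX) jx.
move=> x y; split=> [|xy z zx]; last exact: (total_order_trans tX) xy.
by apply; exact: (total_order_refl tX).
Qed.

(** A family of pairwise incomparable subsets of [kappa + kappa] is provided by
    the sums of a subset of [kappa] with its complement. *)
Lemma large_antichain : exists A : set (LO kappa),
  is_antichain C A /\ A #= [set: kappa -> bool].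
Proof.
have tk := well_order_total_order le_wo.
have [F [F1 _]] := shuffle_family (total_order_sum tk tk)
  (card_le_sumT kappa_inf (card_lexx _) (card_lexx _)).
pose I (a : kappa -> bool) : set (kappa + kappa) :=
  [set i | match i with inl c => a c | inr c => ~~ a c end].
have I_anti a b : I a `<=` I b -> a = b.
  move=> ab; apply/funext => c; have := ab (inl c); have := ab (inr c).
  by rewrite /I /=; case: (a c); case: (b c) => //= H1 H2;
    [have := H2 isT|have := H1 isT].
exists (range (F \o I)); split.
  move=> _ _ [a _ <-] [b _ <-] nab.
  by split=> /F1/I_anti E; apply: nab; rewrite E.
apply: inj_card_eq => a b _ _ E; apply: I_anti; apply: (F1 (I a) (I b)).
have -> : F (I a) = F (I b) by exact: E.
exact: convex_embeds_refl.
Qed.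

End Chains.

(** * The lexicographic order on functions *)

Section Lex.
Variables (kappa : Type) (le : rel kappa).
Hypothesis le_wo : well_order le.
Let tk : total_order le := well_order_total_order le_wo.

Lemma lexP f g : lex le f g <-> f = g \/ exists a : kappa,
  (forall b, strict le b a -> f b = g b) /\ strict le (f a) (g a).
Proof. by split=> /asboolP. Qed.

Lemma first_difference (f g : kappa -> kappa) : f <> g ->
  exists2 a, forall b, strict le b a -> f b = g b & f a <> g a.
Proof.
move=> fg.
have [|a na amin] := well_order_min le_wo (A := [set a | f a <> g a]).
  by apply: contrapT => none; apply: fg; apply/funext => a;
    apply: contrapT => na; apply: none; exists a.
exists a => // b ba; apply: contrapT => /amin ab.
by move: ba; rewrite (strictE tk) ab.
Qed.

Lemma total_order_lex : total_order (lex le).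
Proof.
split; first split; first split.
- by move=> f; apply/lexP; left.
- move=> g f h /lexP[->//|[a [fg fga]]] /lexP[<-|[b [gh ghb]]];
    apply/lexP; right.
    by exists a.
  have [ab|ba] := boolP (strict le a b).
    exists a; rewrite -gh //; split=> // c ca; rewrite fg // gh //.
    by apply: (strict_le_trans tk ca); case/andP: ab.
  move: ba; rewrite (strictE tk) negbK => ba; exists b; split=> [c cb|].
    by rewrite fg ?gh //; exact: (strict_le_trans tk cb).
  have [E|nab] := pselect (a = b).
    by rewrite E in fga; apply: (strict_le_trans tk fga); case/andP: ghb.
  by rewrite fg //; apply: (strict_neq tk ba) => E; apply: nab.
- move=> f g /andP[/lexP[//|[a [fg fga]]] /lexP[//|[b [gf gfb]]]]; exfalso.
  have [ab|] := boolP (strict le a b).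
    by move: fga; rewrite (gf a ab) /strict andbN.
  rewrite (strictE tk) negbK => ba; have [E|nab] := pselect (b = a).
    by move: gfb; rewrite E (strictE tk); case/andP: fga => ->.
  by move: gfb; rewrite (fg b (strict_neq tk ba nab)) /strict andbN.
- move=> f g; have [->|/first_difference[a fg nfg]] := pselect (f = g).
    by apply/orP; left; apply/lexP; left.
  apply/orP; have [fga|/(total_orderW tk) gfa] := boolP (le (f a) (g a)).
    left; apply/lexP; right; exists a; split=> //; exact: (strict_neq tk fga).
  right; apply/lexP; right; exists a; split=> [b ba|]; first by rewrite fg.
  by apply: (strict_neq tk gfa) => E; apply: nfg.
Qed.

Variable z : kappa.
Hypothesis zmin : forall x, le z x.

(** For [p] made of a sequence of some length in [kappa] and of a value: the
    sequence, followed by the value, and then constantly by [z], the minimum of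
    [kappa]. *)
Definition extend (p : {a : kappa & [set b : kappa | strict le b a] -> kappa} *
    kappa) : kappa -> kappa := fun b =>
  match pselect (strict le b (projT1 p.1)) with
  | left ba => projT2 p.1 (SigSub (mem_set (ba :
      [set b : kappa | strict le b (projT1 p.1)] b)))
  | right _ => if pselect (b = projT1 p.1) is left _ then p.2 else z
  end.

(** For [f] strictly below [g], the witness follows [g] up to and including the
    first difference. *)
Lemma extend_dense f g : ~~ lex le g f ->
  exists2 m, range extend m & lex le m g && ~~ lex le m f.
Proof.
have tl := total_order_lex; rewrite -(strictE tl) => /andP[/lexP[->|]].
  by rewrite (total_order_refl tl).
case=> a [fg fga] _.
pose s (b : [set b : kappa | strict le b a]) := g (val b).
set m := extend (existT _ a s, g a).
have mlt b : strict le b a -> m b = g b.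
  by move=> ba; rewrite /m /extend /=; case: pselect.
have ma : m a = g a.
  rewrite /m /extend /=; case: pselect => [aa|_]; last by case: pselect.
  by exfalso; have := aa; rewrite /strict andbN.
have mgt b : strict le a b -> m b = z.
  move=> ab; rewrite /m /extend /=; case: pselect => [ba|_].
    by exfalso; case/andP: ab => ab _; case/andP: ba => _; rewrite ab.
  by case: pselect => // ba; move: ab; rewrite ba /strict andbN.
exists m; first by exists (existT _ a s, g a).
rewrite -(strictE tl); apply/andP; split.
  apply/lexP; have [->|/first_difference[b mg nmg]] := pselect (m = g).
    by left.
  right; exists b; split=> //; have ab : strict le a b.
    rewrite (strictE tk); apply/negP => ba; apply: nmg.
    have [->//|nab] := pselect (b = a).
    by apply: mlt; exact: (strict_neq tk).
  by apply: (strict_neq tk) => //; rewrite mgt.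
apply: (strict_neq tl); last first.
  by move=> E; move: fga; rewrite -ma -E /strict andbN.
by apply/lexP; right; exists a; rewrite ma; split=> // b ba; rewrite mlt // fg.
Qed.

Variable C : set linorder.
Hypotheses (kappa_inf : infinite_set [set: kappa])
  (C_scat : C `<=` Scat kappa) (C_nonempty : C !=set0)
  (C_down : downward_closed kappa C).

(** The eventually minimal functions form a dense subset of [kappa -> kappa], of
    size at most [kappa] by the arithmetical assumption. Two copies of it, the
    first one reversed, separate the points of [Rkappa]. *)
Lemma chain_Rkappa : weak_power_eq le -> has_chain kappa C (Rkappa le).
Proof.
rewrite /weak_power_eq card_eq_le => /andP[wp _].
have tl := total_order_lex.
pose D : set (kappa -> kappa) := range extend.
have Dk : [set: D] #<= [set: kappa].
  apply: card_le_trans (card_le_prodT kappa_inf wp (card_lexx _)).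
  have := card_setT D; rewrite card_eq_le => /andP[/card_le_trans + _].
  by apply; exact: card_image_le.
have tD : total_order (relpre (val : D -> _) (lex le)).
  by apply: (total_order_relpre tl); exact: val_inj.
pose cut (x : (kappa -> kappa) + nonmin le) : set (D + D) :=
  match x with
  | inl f => [set i | if i is inl m then ~~ lex le (val m) f else false]
  | inr f => [set i | if i is inr m then lex le (val m) (val f) else true]
  end.
apply: (chain_of_cuts le_wo kappa_inf C_scat C_nonempty C_down (cut := cut)
  (total_order_sum (total_order_dual tD) tD) (card_le_sumT kappa_inf Dk Dk)).
  move=> [f|f] [m|m] [m'|m'] //=; rewrite /dual_rel /=.
  - by move=> mf mm; apply: contra mf; exact: (total_order_trans tl).
  - by move=> mf mm; exact: (total_order_trans tl) mm mf.
have cutS f g :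
    (forall m : D, lex le (val m) f -> lex le (val m) g) -> lex le f g.
  move=> fg; apply/negPn/negP => /extend_dense[m Dm /andP[mf]].
  by move/negP; apply; exact: (fg (SigSub (mem_set Dm))).
move=> [f|f] [g|g] /=; rewrite /Rkappa /=; split=> // H.
- apply: cutS => m mg; apply/negPn/negP => nmf.
  by have := H (inl m) nmf; rewrite /= mg.
- move=> [m|m] //= mf; apply: contra mf => mg; exact: (total_order_trans tl) H.
- by move=> [m|m].
- (* A non-minimal function has an eventually minimal function below it. *)
  have /existsNP[h fh] : ~ forall h, lex le (val f) h.
    move=> fmin; have := set_mem (valP f); apply; split=> // h _; exact: fmin.
  have /negP/extend_dense[m Dm /andP[mf _]] := fh.
  exact: (H (inr (SigSub (mem_set Dm)))).
- by apply: cutS => m; exact: (H (inr m)).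
- by move=> [m|m] //= mf; exact: (total_order_trans tl) H.
Qed.

End Lex.

Theorem theorem8p6 (kappa : Type) (le : rel kappa)
    (kappa_card : is_cardinal le)
    (kappa_inf : infinite_set [set: kappa])
    (C : set linorder)
    (C_scat : C `<=` Scat kappa)
    (C_nonempty : C !=set0)
    (C_down : downward_closed kappa C)
    (C_trans : forall R S T : LO kappa,
        convex_embeds C R S -> convex_embeds C S T -> convex_embeds C R T) :
  [/\ forall M : linorder, Lin kappa M -> has_chain kappa C M,
      (* ordinals alpha < kappa^+ are the well-orders of size at most kappa *)
      forall (alpha : Type) (R : rel alpha), well_order R ->
        [set: alpha] #<= [set: kappa] ->
        has_chain kappa C R /\ has_chain kappa C (dual_rel R),
      weak_power_eq le -> has_chain kappa C (Rkappa le) &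
      exists A : set (LO kappa),
        is_antichain C A /\ A #= [set: kappa -> bool]].
Proof.
have [le_wo _] := kappa_card.
have chainT (X : Type) (leX : rel X) : total_order leX ->
    [set: X] #<= [set: kappa] -> has_chain kappa C leX.
  exact: (chain_of_total_order le_wo kappa_inf C_scat C_nonempty C_down).
split.
- by move=> M; apply: chainT; exact: lin_total.
- move=> alpha R /well_order_total_order totR alphak.
  by split; apply: chainT => //; exact: total_order_dual.
- have [|z _ zmin] := well_order_min le_wo (A := setT).
    exact: infinite_setN0.
  by apply: (chain_Rkappa le_wo (z := z)) => // x; exact: zmin.
- exact: (large_antichain le_wo kappa_inf C_scat C_nonempty C_down).
Qed.
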